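(* Let $\mathcal{H}$ be a $d$-dimensional Hilbert space and let $\mathscr{A}$ be a simple POVM on $\mathcal{H}$. Then the following statements are equivalent. 1. $\mathscr{A}$ is a PVM. 2. $\mathscr{A}$ is Fisher sharp at some $\rho\in\mathscr{D}(\mathcal{H})$. 3. $\mathscr{A}$ is universally Fisher sharp.
   Context: $\mathcal{H}$ is a complex Hilbert space of finite dimension $d$; $\mathscr{D}(\mathcal{H})$ is the set of positive definite operators of trace 1 on $\mathcal{H}$. POVMs. A POVM on $\mathcal{H}$ is a finite family of positive semidefinite operators on $\mathcal{H}$ summing to the identity. A PVM is a POVM whose elements are (orthogonal) projectors. A POVM is simple if every pair of its elements is linearly independent and it contains no zero element. Parametrizations and Fisher information. Near $\rho\in\mathscr{D}(\mathcal{H})$ choose a parametrization $\rho(\theta)\in\mathscr{D}(\mathcal{H})$ by $g=d^2-1$ real parameters $\theta=(\theta_1,\dots,\theta_g)$, differentiable and with linearly independent derivatives $\rho_{,a}:=\partial\rho(\theta)/\partial\theta_a$ (so they form a basis of the real space of traceless Hermitian operators). For a POVM $\mathscr{A}=\{A_j\}_j$ put $p_j(\theta)=\operatorname{tr}[\rho(\theta)A_j]$. The Fisher information matrix $I(\theta,\mathscr{A})$ has entries $I_{ab}=\sum_{j:A_j\neq0}\frac{1}{p_j}\frac{\partial p_j}{\partial\theta_a}\frac{\partial p_j}{\partial\theta_b}$. The quantum Fisher information matrix $J_{\mathrm S}(\theta)$ has entries $(J_{\mathrm S})_{ab}=\frac12\operatorname{tr}[\rho(L_aL_b+L_bL_a)]$,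 where $L_a$ is the Hermitian operator determined by $\frac12(\rho L_a+L_a\rho)=\rho_{,a}$. The metric-adjusted Fisher information matrix is $I_{\mathrm S}(\theta,\mathscr{A}):=J_{\mathrm S}^{-1/2}(\theta)\,I(\theta,\mathscr{A})\,J_{\mathrm S}^{-1/2}(\theta)$; its eigenvalues at a given $\rho$ do not depend on the parametrization. $\mathscr{A}$ is Fisher sharp at $\rho=\rho(\theta)$ if $I_{\mathrm S}(\theta,\mathscr{A})$ is a projector (i.e. all its nonzero eigenvalues equal 1). $\mathscr{A}$ is universally Fisher sharp if it is Fisher sharp at every $\rho\in\mathscr{D}(\mathcal{H})$. *)

(* Defs.v *)
(* The d-dimensional complex Hilbert space is R[i]^d, with operators represented
   by d x d matrices over R[i], for R : realType. *)
From HB Require Import structures.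
From mathcomp Require Export all_boot all_order all_algebra.
From mathcomp Require Export sesquilinear spectral.
From mathcomp Require Export complex.
From mathcomp Require Export all_classical all_reals all_analysis.

Set Implicit Arguments.
Unset Strict Implicit.
Unset Printing Implicit Defensive.

Import Order.TTheory GRing.Theory Num.Theory.
Import numFieldNormedType.Exports.
Local Open Scope classical_set_scope.
Local Open Scope complex_scope.
Local Open Scope sesquilinear_scope.
Local Open Scope ring_scope.

Section Operators.
Variables (R : realType) (d : nat).
Local Notation C := R[i].
Implicit Types M P rho : 'M[C]_d.

(* In the order of R[i], 0 <= z and 0 < z entail that z is real. *)
Definition possemidefmx M : Prop :=
  M \is hermsymmx /\ forall x : 'cV[C]_d, 0 <= (x ^t* *m M *m x) 0 0.

Definition posdefmx M : Prop :=
  M \is hermsymmx /\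
  forall x : 'cV[C]_d, x != 0 -> 0 < (x ^t* *m M *m x) 0 0.

Definition density rho : Prop := posdefmx rho /\ \tr rho = 1.

Definition projector P : Prop := P \is hermsymmx /\ P *m P = P.

Definition POVM (J : finType) (A : J -> 'M[C]_d) : Prop :=
  (forall j, possemidefmx (A j)) /\ \sum_j A j = 1%:M.

Definition PVM (J : finType) (A : J -> 'M[C]_d) : Prop :=
  POVM A /\ forall j, projector (A j).

Definition simple_POVM (J : finType) (A : J -> 'M[C]_d) : Prop :=
  [/\ POVM A,
      forall j, A j != 0
    & forall j k, j != k -> free [:: A j; A k]].

End Operators.

Section RealMatrices.
Variables (R : realType) (n : nat).
Implicit Types K M P : 'M[R]_n.

Definition real_posdefmx M : Prop :=
  M \is symmetricmx /\
  forall x : 'cV[R]_n, x != 0 -> 0 < (x^T *m M *m x) 0 0.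

Definition real_projector P : Prop := P \is symmetricmx /\ P *m P = P.

(* The unique positive definite square root of M^-1; it exists when M is
   positive definite, which always holds for the quantum Fisher information
   matrix of a parametrization. *)
Definition invsqrtmx M : 'M[R]_n :=
  xget 0 [set K | real_posdefmx K /\ K *m K = invmx M].

End RealMatrices.

Section Fisher.
Variables (R : realType) (d : nat).
Local Notation C := R[i].
Local Notation g := (d ^ 2 - 1)%N.
Implicit Types (rho : 'rV[R]_g -> 'M[C]_d) (theta t : 'rV[R]_g) (a b : 'I_g).

(* 'M[C]_d carries no R-normed structure in the library, so the derivatives of
   t |-> rho t are taken on its real and imaginary parts. *)
Definition mxRe (M : 'M[C]_d) : 'M[R]_d := map_mx (@complex.Re R) M.
Definition mxIm (M : 'M[C]_d) : 'M[R]_d := map_mx (@complex.Im R) M.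

Definition pderiv rho theta a : 'M[C]_d :=
  \matrix_(i, j) ('D_('e_a) (mxRe \o rho) theta i j +i*
                  'D_('e_a) (mxIm \o rho) theta i j).

(* Linear independence is over the reals. *)
Definition lin_indep_pderiv rho theta : Prop :=
  forall c : 'I_g -> R,
    \sum_a (c a)%:C *: pderiv rho theta a = 0 -> forall a, c a = 0.

Definition parametrization rho theta : Prop :=
  \forall t \near theta,
    [/\ density (rho t),
        differentiable (mxRe \o rho) t,
        differentiable (mxIm \o rho) t
      & lin_indep_pderiv rho t].

(* The trace is real when sigma and E are Hermitian. *)
Definition prob (sigma E : 'M[C]_d) : R := complex.Re (\tr (sigma *m E)).

Definition fisher_info (J : finType) (A : J -> 'M[C]_d) rho theta : 'M[R]_g :=
  \matrix_(a, b) \sum_(j | A j != 0)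
    (prob (rho theta) (A j))^-1 *
    'D_('e_a) (fun t => prob (rho t) (A j)) theta *
    'D_('e_b) (fun t => prob (rho t) (A j)) theta.

(* The symmetric logarithmic derivative; it exists and is unique when sigma is
   positive definite and X is Hermitian. *)
Definition sld (sigma X : 'M[C]_d) : 'M[C]_d :=
  xget 0 [set L | L \is hermsymmx /\
                  2^-1 *: (sigma *m L + L *m sigma) = X].

Definition quantum_fisher_info rho theta : 'M[R]_g :=
  let L a := sld (rho theta) (pderiv rho theta a) in
  \matrix_(a, b) complex.Re
    (2^-1 * \tr (rho theta *m (L a *m L b + L b *m L a))).

Definition adjusted_fisher_info (J : finType) (A : J -> 'M[C]_d) rho theta :
    'M[R]_g :=
  let K := invsqrtmx (quantum_fisher_info rho theta) in
  K *m fisher_info A rho theta *m K.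

(* The spectrum of adjusted_fisher_info at sigma does not depend on the
   parametrization, so "some" and "every" parametrization are equivalent. *)
Definition fisher_sharp (J : finType) (A : J -> 'M[C]_d) (sigma : 'M[C]_d) :
    Prop :=
  exists (rho : 'rV[R]_g -> 'M[C]_d) (theta : 'rV[R]_g),
    [/\ parametrization rho theta,
        rho theta = sigma
      & real_projector (adjusted_fisher_info A rho theta)].

Definition universally_fisher_sharp (J : finType) (A : J -> 'M[C]_d) : Prop :=
  forall sigma : 'M[C]_d, density sigma -> fisher_sharp A sigma.

End Fisher.

(* Main.v *)
Require Import Defs.
From mathcomp Require Import lra ring.

(* For Hermitian X, Y put <X, Y> = Re tr (s (X Y + Y X)) / 2, a real inner
   product since s > 0. If L_a are the symmetric logarithmic derivatives, then
   J_S is their Gram matrix, they form a basis of the orthogonal complement of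
   1, and I = V W V^T with V_aj = <L_a, A_j> and W = diag (1 / p_j). Fisher
   sharpness reads I J_S^-1 I = I, that is, the operator
   F X = sum_j <A_j, X> / p_j A_j is an orthogonal projection, hence fixes every
   A_k. For a PVM the A_j are orthogonal with <A_j, A_j> = p_j, so this holds.
   Conversely F A_k = A_k gives <A_k, A_k> = sum_j <A_j, A_k>^2 / p_j, and the
   equality case of Kadison's inequality forces A_k A_j to be a scalar multiple
   of A_j for all j, k. Taking adjoints, A_k A_j is a multiple of A_k as well,
   so pairwise independence gives A_k A_j = 0 for j != k, and summing over k
   yields A_j^2 = A_j. *)

Set Implicit Arguments.
Unset Strict Implicit.
Unset Printing Implicit Defensive.

Import Order.TTheory GRing.Theory Num.Theory.
Import numFieldNormedType.Exports.
Local Open Scope classical_set_scope.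
Local Open Scope complex_scope.
Local Open Scope sesquilinear_scope.
Local Open Scope ring_scope.

(** * Square roots of positive matrices and the Sylvester equation *)

Section ComplexMatrices.
Variable R : realType.
Local Notation C := R[i].

Lemma hermsymmxP d (M : 'M[C]_d) : reflect (M ^t* = M) (M \is hermsymmx).
Proof.
by apply: (iffP (is_hermitianmxP _ _ _)); rewrite expr0 scale1r => /esym.
Qed.

Lemma symmetricmxP n (M : 'M[R]_n) : reflect (M^T = M) (M \is symmetricmx).
Proof.
by apply: (iffP (is_hermitianmxP _ _ _));
  rewrite expr0 scale1r map_mx_id // => /esym.
Qed.

Lemma adjmxM m n p (M : 'M[C]_(m, n)) (N : 'M[C]_(n, p)) :
  (M *m N) ^t* = N ^t* *m M ^t*.
Proof. by rewrite trmx_mul map_mxM. Qed.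

Lemma adjmul_form m n (M : 'M[C]_(m, n)) (x : 'cV[C]_n) :
  (x ^t* *m (M ^t* *m M) *m x) 0 0 = \tr ((M *m x) ^t* *m (M *m x)).
Proof. by rewrite adjmxM trace_mx11 !mulmxA. Qed.

Lemma mxtrace_adjmul_sum m n (M : 'M[C]_(m, n)) :
  \tr (M ^t* *m M) = \sum_i \sum_j `|M j i| ^+ 2.
Proof.
apply: eq_bigr => i _; rewrite mxE; apply: eq_bigr => j _.
by rewrite !mxE mulrC -normCK.
Qed.

Lemma mxtrace_adjmul_ge0 m n (M : 'M[C]_(m, n)) : 0 <= \tr (M ^t* *m M).
Proof.
by rewrite mxtrace_adjmul_sum; do 2![apply: sumr_ge0 => ? _]; rewrite exprn_ge0.
Qed.

Lemma mxtrace_adjmul_eq0 m n (M : 'M[C]_(m, n)) :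
  \tr (M ^t* *m M) = 0 -> M = 0.
Proof.
rewrite mxtrace_adjmul_sum => /eqP; rewrite psumr_eq0 => [/allP M0|i _]; last first.
  by apply: sumr_ge0 => ? _; rewrite exprn_ge0.
apply/matrixP => j i; rewrite mxE; apply/eqP.
have := M0 i; rewrite mem_index_enum => /(_ isT).
rewrite /= psumr_eq0 => [/allP /(_ j)|k _]; last by rewrite exprn_ge0.
by rewrite mem_index_enum => /(_ isT) /=; rewrite sqrf_eq0 normr_eq0.
Qed.

Lemma mxtrace_adjmul_gt0 m n (M : 'M[C]_(m, n)) :
  M != 0 -> 0 < \tr (M ^t* *m M).
Proof.
move=> M0; rewrite lt_neqAle mxtrace_adjmul_ge0 andbT eq_sym.
by apply: contraNneq M0 => /mxtrace_adjmul_eq0 ->.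
Qed.

(** By unitary diagonalization: the eigenvalues are values of the form at eigenvectors, hence
    nonnegative, and have square roots. *)
Lemma possemidefmx_sqrt d (M : 'M[C]_d) : possemidefmx M ->
  exists K, possemidefmx K /\ K *m K = M.
Proof.
case=> Mh Mge0; have /hermitian_normalmx /orthomx_spectralP := Mh.
set P := spectralmx M; set D := spectral_diag M => ME.
have Pu : P \is unitarymx by exact: spectral_unitarymx.
have PPs : P *m P ^t* = 1%:M by apply/unitarymxP.
rewrite (invmx_unitary Pu) in ME.
have Dge0 i : 0 <= D 0 i.
  have := Mge0 (P ^t* *m delta_mx i 0).
  have PMP : P *m M *m P ^t* = diag_mx D.
    by rewrite ME !mulmxA PPs mul1mx -mulmxA PPs mulmx1.
  rewrite adjmxM trmxCK trmx_delta map_delta_mx.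
  rewrite -(mulmxA _ P) -(mulmxA _ (P *m M)) (mulmxA (P *m M)) PMP.
  by rewrite -rowE -colE !mxE eqxx mulr1n.
exists (P ^t* *m diag_mx (map_mx sqrtC D) *m P).
(* With fourth roots of the eigenvalues the candidate reads [T ^t* *m T], which makes it Hermitian
   and positive at once. *)
pose T := diag_mx (map_mx sqrtC (map_mx sqrtC D)) *m P.
have TE : P ^t* *m diag_mx (map_mx sqrtC D) *m P = T ^t* *m T.
  rewrite adjmxM tr_diag_mx map_diag_mx !mulmxA -[_ *m diag_mx _ *m diag_mx _]mulmxA.
  rewrite mulmx_diag; congr (_ *m diag_mx _ *m _); apply/rowP => i.
  rewrite !mxE /= geC0_conj; first by rewrite -expr2 sqrtCK.
  by rewrite !sqrtC_ge0.
split; last first.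
  rewrite !mulmxA -[_ *m P *m P ^t*]mulmxA PPs mulmx1 ME.
  rewrite -[_ *m diag_mx _ *m diag_mx _]mulmxA mulmx_diag.
  by congr (_ *m diag_mx _ *m _); apply/rowP => i; rewrite !mxE -expr2 sqrtCK.
rewrite TE; split=> [|x]; first by apply/hermsymmxP; rewrite adjmxM trmxCK.
rewrite adjmul_form; exact: mxtrace_adjmul_ge0.
Qed.

Lemma posdefmx_possemidef d (M : 'M[C]_d) : posdefmx M -> possemidefmx M.
Proof.
case=> Mh Mp; split=> // x; have [->|/Mp/ltW//] := eqVneq x 0.
by rewrite mulmx0 mxE.
Qed.

Lemma posdefmx_unit d (M : 'M[C]_d) : posdefmx M -> M \in unitmx.
Proof.
case=> _ Mp; rewrite -unitmx_tr -row_free_unit; apply: inj_row_free => v vM.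
apply/eqP; apply: contraT => v0; have /Mp : v^T != 0 by rewrite trmx_eq0.
by rewrite -mulmxA -(trmxK M) -trmx_mul vM trmx0 mulmx0 mxE ltxx.
Qed.

(** With [M = K *m K] the form at [x] is the squared norm of [K *m x], and [K] has trivial kernel
    when [M] is invertible. *)
Lemma possemidefmx_unit_posdef d (M : 'M[C]_d) :
  possemidefmx M -> M \in unitmx -> posdefmx M.
Proof.
move=> /[dup] Mp /possemidefmx_sqrt[K [[/hermsymmxP Kh _] KK]] Mu.
split=> [|x x0]; first exact: Mp.1.
rewrite -KK -{1}Kh adjmul_form; apply: mxtrace_adjmul_gt0; apply: contraNneq x0 => Kx0.
by rewrite -(mulKmx Mu x) -KK -mulmxA Kx0 !mulmx0.
Qed.

Lemma posdefmx_sqrt d (M : 'M[C]_d) : posdefmx M ->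
  exists K, posdefmx K /\ K *m K = M.
Proof.
move=> /[dup] /posdefmx_unit Mu /posdefmx_possemidef /possemidefmx_sqrt[K [Kp KK]].
exists K; split=> //; apply: possemidefmx_unit_posdef => //.
by move: Mu; rewrite -KK unitmx_mul => /andP[].
Qed.

(* [tr (X^* (M X + X N))] is the sum of two nonnegative terms. *)
Lemma sylvester_inj d (M N X : 'M[C]_d) : posdefmx M -> posdefmx N ->
  M *m X + X *m N = 0 -> X = 0.
Proof.
move=> /posdefmx_sqrt[K [Kp KK]] /posdefmx_sqrt[H [Hp HH]] MXN.
have /hermsymmxP Kh := Kp.1; have /hermsymmxP Hh := Hp.1.
have sum0 : \tr ((K *m X) ^t* *m (K *m X)) + \tr ((X *m H) ^t* *m (X *m H)) = 0.
  have -> : \tr ((X *m H) ^t* *m (X *m H)) = \tr (X ^t* *m (X *m N)).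
    by rewrite adjmxM Hh -HH -mulmxA mxtrace_mulC !mulmxA.
  by rewrite adjmxM Kh -mulmxA (mulmxA K K) KK -raddfD -mulmxDr MXN mulmx0 raddf0.
have KX0 : K *m X = 0.
  apply: mxtrace_adjmul_eq0; apply/le_anti; rewrite mxtrace_adjmul_ge0 andbT.
  by rewrite -sum0 lerDl mxtrace_adjmul_ge0.
by rewrite -(mulKmx (posdefmx_unit Kp) X) KX0 mulmx0.
Qed.
End ComplexMatrices.

(** * Solvability of the symmetric logarithmic derivative equation *)

Section Sld.
Variables (R : realType) (d : nat).
Local Notation C := R[i].

(** The map [L |-> s L + L s] is injective by [sylvester_inj], hence bijective in finite dimension.
    The adjoint of a solution solves the same equation, so injectivity makes the solution
    Hermitian. *)
Lemma sldP (s X : 'M[C]_d) : posdefmx s -> X \is hermsymmx ->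
  sld s X \is hermsymmx /\ 2^-1 *: (s *m sld s X + sld s X *m s) = X.
Proof.
move=> sp /hermsymmxP Xh; have /hermsymmxP sh := sp.1.
have two0 : (2 : C) != 0 by rewrite pnatr_eq0.
apply: (@xgetPex _ 0 [set L | L \is hermsymmx /\
                  2^-1 *: (s *m L + L *m s) = X]).
have mulE L : mxvec L *m (lin_mulmx s + lin_mulmxr s) = mxvec (s *m L + L *m s).
  by rewrite mulmxDr !mul_vec_lin /= -raddfD.
have /mulmxKV V : lin_mulmx s + lin_mulmxr s \in unitmx.
  rewrite -row_free_unit; apply: inj_row_free => v.
  rewrite -[v]vec_mxK mulE => /eqP; rewrite mxvec_eq0 => /eqP /(sylvester_inj sp sp) ->.
  by rewrite linear0.
pose L := vec_mx (mxvec (2 *: X) *m invmx (lin_mulmx s + lin_mulmxr s)).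
have LE : s *m L + L *m s = 2 *: X.
  by apply: (can_inj mxvecK); rewrite -mulE vec_mxK V.
exists L; split; last by rewrite LE scalerA mulVf // scale1r.
have LsE : s *m L ^t* + L ^t* *m s = 2 *: X.
  have := congr1 (fun Y => Y ^t*) LE.
  rewrite /= raddfD map_mxD /= !adjmxM sh linearZ /= map_mxZ Xh addrC => ->.
  by rewrite rmorph_nat.
apply/hermsymmxP/eqP; rewrite -subr_eq0; apply/eqP/(sylvester_inj sp sp).
by rewrite mulmxBr mulmxBl addrACA -opprD LE LsE subrr.
Qed.

End Sld.

(** * Square roots of real positive definite matrices *)

Section RealSqrt.
Variables (R : realType) (n : nat).
Local Notation C := R[i].
Local Notation cmx := (map_mx (real_complex R)).

Lemma cmx_adj m k (M : 'M[R]_(m, k)) : (cmx M) ^t* = cmx M^T.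
Proof. by apply/matrixP => i j; rewrite !mxE; exact: conjc_real. Qed.

(** Writing [z = x + i y], symmetry of [M] cancels the cross terms and leaves the sum of the real
    forms at [x] and [y]; at least one of these vectors is nonzero. *)
Lemma real_posdefmx_complex (M : 'M[R]_n) : real_posdefmx M -> posdefmx (cmx M).
Proof.
case=> /symmetricmxP Ms Mp.
split=> [|z z0]; first by apply/hermsymmxP; rewrite cmx_adj Ms.
set x := map_mx (@complex.Re R) z; set y := map_mx (@complex.Im R) z.
have zE : z = cmx x + 'i%C *: cmx y.
  by apply/matrixP => i j; rewrite !mxE [LHS]complexE.
have zsE : z ^t* = cmx x^T - 'i%C *: cmx y^T.
  rewrite [in LHS]zE raddfD /= map_mxD -!cmx_adj linearZ /= map_mxZ /= -scaleNr.
  by congr (_ + _ *: _); rewrite /= -conjCi.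
have Mge0 (u : 'cV[R]_n) : 0 <= (u^T *m M *m u) 0 0.
  by have [->|u0] := eqVneq u 0; [rewrite mulmx0 mxE | exact: ltW (Mp _ u0)].
have -> : (z ^t* *m cmx M *m z) 0 0 =
    ((x^T *m M *m x) 0 0 + (y^T *m M *m y) 0 0)%:C.
  rewrite zsE [in LHS]zE !(mulmxDl, mulmxDr, mulNmx, =^~ scalemxAl, =^~ scalemxAr).
  rewrite -!map_mxM.
  have -> : y^T *m M *m x = x^T *m M *m y.
    by rewrite [RHS]mx11_scalar -tr_scalar_mx -mx11_scalar !trmx_mul trmxK Ms mulmxA.
  by rewrite addrA subrK scalerA -expr2 sqr_i scaleN1r opprK !mxE raddfD.
rewrite ltcR.
have [x0|x0] := eqVneq x 0; last by rewrite ltr_wpDr // Mp.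
rewrite ltr_wpDl // Mp //; apply: contraNneq z0 => y0.
by rewrite zE x0 y0 !raddf0 addr0.
Qed.

Lemma real_posdefmx_sqrt (M : 'M[R]_n) : real_posdefmx M ->
  exists K, real_posdefmx K /\ K *m K = M.
Proof.
move=> /real_posdefmx_complex Mp.
have [K [Kp KK]] := posdefmx_sqrt Mp; have /hermsymmxP Kh := Kp.1.
(* [K'], the conjugate of [K], is also a positive square root, so [K] is real. *)
pose K' := map_mx Num.conj K.
have K'p : posdefmx K'.
  split=> [|x x0].
    by apply/hermsymmxP; rewrite map_trmx Kh.
  pose x' := map_mx Num.conj x.
  have x'x : map_mx Num.conj x' = x by apply/matrixP => i j; rewrite !mxE conjCK.
  have x'0 : x' != 0 by apply: contraNneq x0 => x'0; rewrite -x'x x'0 map_mx0.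
  have -> : x ^t* *m K' *m x = map_mx Num.conj (x' ^t* *m K *m x').
    by rewrite !map_mxM -!map_trmx x'x.
  by rewrite mxE /= geC0_conj ?ltW // Kp.2.
have K'K' : K' *m K' = cmx M.
  by rewrite -map_mxM KK; apply/matrixP => i j; rewrite !mxE; exact: conjc_real.
(* The difference [X = K - K'] solves [K *m X + X *m K' = 0], because [K] and [K'] have the same
   square. *)
have KE : K = K'.
  apply/eqP; rewrite -subr_eq0; apply/eqP/(sylvester_inj Kp K'p).
  by rewrite mulmxBr mulmxBl KK K'K' addrA subrK subrr.
pose H := map_mx (@complex.Re R) K.
have HK : K = cmx H.
  apply/matrixP => i j; rewrite !mxE; apply/esym/RRe_real.
  by rewrite CrealE; move/matrixP: KE => /(_ i j); rewrite mxE => <-.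
exists H; split; last by apply: (map_mx_inj (f := real_complex R)); rewrite map_mxM -HK.
split=> [|x x0].
  by apply/symmetricmxP/(map_mx_inj (f := real_complex R)); rewrite -cmx_adj -HK.
rewrite -ltcR; have /Kp.2 : cmx x != 0 by rewrite map_mx_eq0.
by rewrite HK cmx_adj -!map_mxM mxE.
Qed.

End RealSqrt.

(** * Projector conditions as identities between real matrices *)

Section RealProjectors.
Variable R : realType.

Lemma real_posdefmx_unit n (M : 'M[R]_n) : real_posdefmx M -> M \in unitmx.
Proof.
move=> /real_posdefmx_complex /posdefmx_unit.
by rewrite map_unitmx.
Qed.

Lemma invsqrtmxP n (M : 'M[R]_n) : real_posdefmx M ->
  real_posdefmx (invsqrtmx M) /\ invsqrtmx M *m invsqrtmx M = invmx M.
Proof.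
move=> /[dup] Mp [/symmetricmxP Ms Mpos]; have Mu := real_posdefmx_unit Mp.
apply: (@xgetPex _ 0 [set K | real_posdefmx K /\ K *m K = invmx M]).
apply: real_posdefmx_sqrt; split=> [|x x0].
  by apply/symmetricmxP; rewrite trmx_inv Ms.
(* The form of the inverse at [x] is the form of [M] at [invmx M *m x]. *)
have /Mpos : invmx M *m x != 0.
  by apply: contraNneq x0 => Mx0; rewrite -(mulKVmx Mu x) Mx0 mulmx0.
by rewrite trmx_mul trmx_inv Ms -[_ *m M]mulmxA mulVmx // mulmx1 mulmxA.
Qed.

(** With [K = invsqrtmx M], the square of [K F K] is [K (F M^-1 F) K], and the invertible outer
    factors cancel. *)
Lemma real_projector_invsqrt n (M F : 'M[R]_n) : real_posdefmx M -> F^T = F ->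
  real_projector (invsqrtmx M *m F *m invsqrtmx M) <-> F *m invmx M *m F = F.
Proof.
move=> /invsqrtmxP[[/symmetricmxP Ks Kpos] KK] Fs.
have Ku : invsqrtmx M \in unitmx.
  by apply: real_posdefmx_unit; split=> //; apply/symmetricmxP.
have PP : invsqrtmx M *m F *m invsqrtmx M *m (invsqrtmx M *m F *m invsqrtmx M) =
    invsqrtmx M *m (F *m invmx M *m F) *m invsqrtmx M.
  by rewrite -KK !mulmxA.
split=> [[_]|FMF]; last first.
  by split; [apply/symmetricmxP; rewrite !trmx_mul Ks Fs mulmxA | rewrite PP FMF].
rewrite PP => /(congr1 (fun X => X *m invmx (invsqrtmx M))); rewrite !mulmxK //.
by move=> /(congr1 (fun X => invmx (invsqrtmx M) *m X)); rewrite !mulKmx.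
Qed.

(** Each diagonal entry of the product is a sum, with positive weights, of the squares along one row
    of [D]. *)
Lemma diag_form_eq0 m n (D : 'M[R]_(m, n)) (w : 'rV[R]_n) :
  (forall j, 0 < w 0 j) -> D *m diag_mx w *m D^T = 0 -> D = 0.
Proof.
move=> w0 DwD; apply/matrixP => a j; rewrite mxE.
have /matrixP /(_ a a) := DwD; rewrite mul_mx_diag mxE [RHS]mxE.
under eq_bigr do rewrite !mxE mulrAC -expr2.
move=> /eqP; rewrite psumr_eq0 => [/allP /(_ j)|k _]; last first.
  by rewrite mulr_ge0 ?sqr_ge0 ?ltW.
rewrite mem_index_enum => /(_ isT) /=.
by rewrite mulf_eq0 sqrf_eq0 (gt_eqF (w0 j)) orbF => /eqP.
Qed.

(* The difference [D] of the two sides satisfies [D W D^T = 0]. *)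
Lemma gram_fisher_eq m n (M : 'M[R]_m) (V : 'M[R]_(m, n)) (w : 'rV[R]_n) :
    M^T = M -> (forall j, 0 < w 0 j) ->
    let F := V *m diag_mx w *m V^T in
  F *m invmx M *m F = F -> V *m diag_mx w *m (V^T *m invmx M *m V) = V.
Proof.
move=> Ms w0 F FMF; apply/eqP; rewrite -subr_eq0; apply/eqP.
apply: (diag_form_eq0 w0).
set D := (X in X *m _ *m _).
have DE : D = (F *m invmx M - 1%:M) *m V by rewrite mulmxBl mul1mx /D /F !mulmxA.
have -> : D *m diag_mx w *m D^T = (F *m invmx M *m F - F) *m (F *m invmx M - 1%:M)^T.
  rewrite {2}DE trmx_mul mulmxA; congr (_ *m _).
  by rewrite DE -(mulmxA _ V) -(mulmxA _ (V *m _)) -/F mulmxBl mul1mx.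
by rewrite FMF subrr mul0mx.
Qed.

End RealProjectors.

(** * The inner product [<X, Y>] and real coordinates on Hermitian matrices *)

Section Jordan.
Variables (R : realType) (d : nat).
Local Notation C := R[i].
Implicit Types (s X Y Z H : 'M[C]_d).

Lemma Re_real_mul (x : R) (z : C) : complex.Re (x%:C * z) = x * complex.Re z.
Proof. by case: z => a b /=; rewrite mul0r subr0. Qed.

Lemma ReD (y z : C) : complex.Re (y + z) = complex.Re y + complex.Re z.
Proof. by case: y z => a b [a' b']. Qed.

Lemma Re_sum (I : finType) (F : I -> C) :
  complex.Re (\sum_i F i) = \sum_i complex.Re (F i).
Proof. exact: (big_morph _ ReD (erefl (complex.Re (0 : C)))). Qed.

(** The form [<X, Y>] at the state [s]. Linearity is proved in the second argument; symmetry
    transfers it to the first. *)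
Definition jordan_form s X Y : R :=
  complex.Re (2^-1 * \tr (s *m (X *m Y + Y *m X))).

Lemma jordan_formC s X Y : jordan_form s X Y = jordan_form s Y X.
Proof. by rewrite /jordan_form addrC. Qed.

Lemma jordan_formD s X Y Z :
  jordan_form s X (Y + Z) = jordan_form s X Y + jordan_form s X Z.
Proof.
by rewrite /jordan_form -ReD -mulrDr -mxtraceD -mulmxDr addrACA -mulmxDr -mulmxDl.
Qed.

Lemma jordan_formZ s X (c : R) Y :
  jordan_form s X (c%:C *: Y) = c * jordan_form s X Y.
Proof.
rewrite /jordan_form -scalemxAl -scalemxAr -scalerDr -scalemxAr mxtraceZ.
by rewrite mulrCA Re_real_mul.
Qed.

Lemma jordan_form0 s X : jordan_form s X 0 = 0.
Proof. by rewrite /jordan_form mulmx0 mul0mx addr0 mulmx0 raddf0 mulr0. Qed.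

Lemma jordan_form_sum (I : finType) s X (Y : I -> 'M[C]_d) :
  jordan_form s X (\sum_i Y i) = \sum_i jordan_form s X (Y i).
Proof. exact: (big_morph _ (jordan_formD s X) (jordan_form0 s X)). Qed.

Lemma jordan_form1 s X : jordan_form s 1%:M X = prob s X.
Proof.
rewrite /jordan_form mul1mx mulmx1 mulmxDr mxtraceD -mulr2n -(mulr_natl (\tr _)).
by rewrite mulKf // pnatr_eq0.
Qed.

(** A square root [K] of the state turns [<X, X>] into the squared Hilbert-Schmidt norm of [X *m K],
    which is how positivity is obtained. *)
Lemma jordan_form_sqr (K X : 'M[C]_d) : K \is hermsymmx -> X \is hermsymmx ->
  (jordan_form (K *m K) X X)%:C = \tr ((X *m K) ^t* *m (X *m K)).
Proof.
move=> /hermsymmxP Kh /hermsymmxP Xh; rewrite adjmxM Kh Xh.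
have -> : jordan_form (K *m K) X X = prob (K *m K) (X *m X).
  by rewrite -jordan_form1 /jordan_form mul1mx mulmx1.
rewrite /prob.
have -> : \tr (K *m K *m (X *m X)) = \tr (K *m X *m (X *m K)).
  by rewrite -mulmxA mxtrace_mulC !mulmxA.
rewrite RRe_real // ger0_real //.
by have := mxtrace_adjmul_ge0 (X *m K); rewrite adjmxM Kh Xh.
Qed.

Lemma jordan_form_gt0 s X : posdefmx s -> X \is hermsymmx -> X != 0 ->
  0 < jordan_form s X X.
Proof.
move=> /posdefmx_sqrt[K [Kp <-]] Xh X0.
rewrite -ltcR jordan_form_sqr //; last exact: Kp.1.
apply: mxtrace_adjmul_gt0; apply: contraNneq X0 => XK0.
by rewrite -(mulmxK (posdefmx_unit Kp) X) XK0 mul0mx.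
Qed.

(* On Hermitian matrices this is a bijection onto real matrices: Re X is the
   symmetric part of Re X + Im X and Im X the antisymmetric part. *)
Definition hermvec (X : 'M[C]_d) : 'rV[R]_(d * d) := mxvec (mxRe X + mxIm X).

Lemma hermvecD X Y : hermvec (X + Y) = hermvec X + hermvec Y.
Proof. by rewrite /hermvec -raddfD /mxRe /mxIm !map_mxD addrACA. Qed.

Lemma hermvec0 : hermvec 0 = 0.
Proof. by apply: (addrI (hermvec 0)); rewrite -hermvecD !addr0. Qed.

Lemma hermvecZ (c : R) X : hermvec (c%:C *: X) = c *: hermvec X.
Proof.
rewrite /hermvec -linearZ; congr mxvec; apply/matrixP => i j; rewrite !mxE.
by case: (X i j) => a b /=; rewrite !mul0r subr0 addr0 mulrDr.
Qed.

Lemma hermvec_sum (I : finType) (c : I -> R) (X : I -> 'M[C]_d) :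
  hermvec (\sum_i (c i)%:C *: X i) = \sum_i c i *: hermvec (X i).
Proof.
by rewrite (big_morph _ hermvecD hermvec0); apply: eq_bigr => i _; rewrite hermvecZ.
Qed.

Lemma hermvecB X Y : hermvec (X - Y) = hermvec X - hermvec Y.
Proof. by apply/eqP; rewrite eq_sym subr_eq -hermvecD subrK. Qed.

Lemma hermvec_eq0 X : X \is hermsymmx -> hermvec X = 0 -> X = 0.
Proof.
move=> /hermsymmxP /matrixP Xh /eqP; rewrite mxvec_eq0 => /eqP /matrixP X0.
apply/matrixP => i j; rewrite mxE.
have := X0 i j; have := X0 j i; have := Xh i j; rewrite !mxE.
case: (X i j) (X j i) => [a b] [a' b'] /= [<- <-] h1 h2.
have a0 : a' = 0 by lra.
have b0 : b' = 0 by lra.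
by rewrite a0 b0 oppr0.
Qed.

Lemma hermsymmxD X Y :
  X \is hermsymmx -> Y \is hermsymmx -> X + Y \is hermsymmx.
Proof.
move=> /hermsymmxP Xh /hermsymmxP Yh; apply/hermsymmxP.
by rewrite raddfD map_mxD /= Xh Yh.
Qed.

Lemma hermsymmxB X Y :
  X \is hermsymmx -> Y \is hermsymmx -> X - Y \is hermsymmx.
Proof.
move=> /hermsymmxP Xh /hermsymmxP Yh; apply/hermsymmxP.
by rewrite raddfB map_mxB /= Xh Yh.
Qed.

Lemma hermsymmxZ (c : R) X : X \is hermsymmx -> c%:C *: X \is hermsymmx.
Proof.
move=> /hermsymmxP Xh; apply/hermsymmxP; rewrite linearZ /= map_mxZ Xh.
by congr (_ *: _); exact: conjc_real.
Qed.

Lemma hermsymmx1 : (1%:M : 'M[C]_d) \is hermsymmx.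
Proof. by apply/hermsymmxP; rewrite trmx1 map_mx1. Qed.

Lemma hermsymmx_sum (I : finType) (c : I -> R) (X : I -> 'M[C]_d) :
  (forall i, X i \is hermsymmx) -> \sum_i (c i)%:C *: X i \is hermsymmx.
Proof.
move=> Xh; apply: (big_ind (fun Y : 'M[C]_d => Y \is hermsymmx)) => [||i _].
- by apply/hermsymmxP; rewrite trmx0 map_mx0.
- exact: hermsymmxD.
- exact: hermsymmxZ.
Qed.

(** A dimension count: the [L a] and the identity are [d ^ 2] independent vectors in the real space
    of Hermitian matrices. Pairing with the identity, to which all [L a] are orthogonal, isolates
    its coefficient. *)
Lemma hermsymmx_span s (L : 'I_(d ^ 2 - 1) -> 'M[C]_d) H : (0 < d)%N ->
    prob s 1%:M = 1 ->
    (forall a, L a \is hermsymmx) -> (forall a, jordan_form s 1%:M (L a) = 0) ->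
    (forall c : 'I_(d ^ 2 - 1) -> R,
       \sum_a (c a)%:C *: L a = 0 -> forall a, c a = 0) ->
    H \is hermsymmx ->
  exists c : 'I_(d ^ 2 - 1) -> R,
    H = (prob s H)%:C *: 1%:M + \sum_a (c a)%:C *: L a.
Proof.
move=> d0 s1 Lh sL Lfree Hh.
pose B := col_mx (\matrix_a hermvec (L a)) (hermvec 1%:M).
pose comb (v : 'rV_(d ^ 2 - 1 + 1)) :=
  \sum_a (lsubmx v 0 a)%:C *: L a + (rsubmx v 0 0)%:C *: 1%:M.
have combh v : comb v \is hermsymmx.
  by apply: hermsymmxD; [exact: hermsymmx_sum | apply/hermsymmxZ/hermsymmx1].
have combE v : v *m B = hermvec (comb v).
  rewrite hermvecD hermvecZ hermvec_sum -[in LHS](hsubmxK v) mul_row_col.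
  rewrite !mulmx_sum_row big_ord1 row_id; congr (_ + _).
  by apply: eq_bigr => a _; rewrite rowK.
have prob_comb v : prob s (comb v) = rsubmx v 0 0.
  rewrite -jordan_form1 jordan_formD jordan_formZ (jordan_form1 s 1%:M) s1 mulr1.
  rewrite jordan_form_sum big1 ?add0r // => a _.
  by rewrite jordan_formZ sL mulr0.
have /eqP Bfree : row_free B.
  apply: inj_row_free => v; rewrite combE => /(hermvec_eq0 (combh v)) v0.
  have r0 : rsubmx v 0 0 = 0.
    by rewrite -prob_comb v0 -jordan_form1 jordan_form0.
  rewrite /comb r0 scale0r addr0 in v0.
  rewrite -(hsubmxK v) -[RHS]row_mx0.
  congr row_mx; apply/rowP => a; rewrite [RHS]mxE.
    exact: Lfree v0 a.
  by rewrite ord1.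
(* Since [0 < d], the truncated subtraction is exact, [d ^ 2 - 1 + 1 = d * d], and [B] is square. *)
have Bfull : row_full B.
  by rewrite /row_full Bfree subnK ?expn_gt0 ?d0 // mulnn.
have /submxP[v] := submx_full (hermvec H) Bfull.
rewrite combE => HE; exists (lsubmx v 0).
have HvE : H = comb v.
  apply/eqP; rewrite -subr_eq0; apply/eqP/hermvec_eq0; first exact: hermsymmxB.
  by rewrite hermvecB HE subrr.
by rewrite addrC [prob s H](_ : _ = rsubmx v 0 0) // HvE prob_comb.
Qed.

End Jordan.

(** * Partial derivatives of states and of outcome probabilities *)

Section Derivatives.
Variables (R : realType) (d : nat).
Local Notation C := R[i].
Local Notation mxRe := (@mxRe R d).
Local Notation mxIm := (@mxIm R d).
Local Notation g := (d ^ 2 - 1)%N.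
Implicit Types (rho : 'rV[R]_g -> 'M[C]_d) (theta t : 'rV[R]_g) (a b : 'I_g).

(** Exhibits the probability as a real linear function of the real and imaginary entries of [s], the
    shape in which it is differentiated. *)
Lemma prob_entries (s E : 'M[C]_d) :
  prob s E = \sum_i \sum_j (complex.Re (E j i) * mxRe s i j -
                            complex.Im (E j i) * mxIm s i j).
Proof.
rewrite /prob /mxtrace Re_sum; apply: eq_bigr => i _.
rewrite mxE Re_sum; apply: eq_bigr => j _.
rewrite !mxE; case: (s i j) (E j i) => a b [a' b'] /=.
by rewrite [a * _]mulrC [b * _]mulrC.
Qed.

Lemma derive_prob rho theta a (E : 'M[C]_d) :
    differentiable (mxRe \o rho) theta -> differentiable (mxIm \o rho) theta ->
  'D_('e_a) (fun t => prob (rho t) E) theta = prob (pderiv rho theta a) E.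
Proof.
move=> dRe dIm.
have entry (f : 'rV[R]_g -> 'M[R]_d) i j : differentiable f theta ->
    is_derive theta 'e_a (fun t => f t i j) ('D_('e_a) f theta i j).
  move=> /diff_derivable df; apply: DeriveDef.
    exact: (derivable_mxP f theta 'e_a).1.
  by rewrite (derive_mx (df _)) mxE.
pose h i j : 'rV[R]_g -> R :=
  complex.Re (E j i) \*: (fun t => (mxRe \o rho) t i j) -
  complex.Im (E j i) \*: (fun t => (mxIm \o rho) t i j).
have -> : (fun t => prob (rho t) E) = \sum_i \sum_j h i j.
  apply/funext => t; rewrite fct_sumE prob_entries; apply: eq_bigr => i _.
  by rewrite fct_sumE.
rewrite prob_entries.
apply: (@derive_val _ _ _ _ _ _ _ _).
apply: is_derive_sum => i; apply: is_derive_sum => j.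
have := is_deriveB (is_deriveZ (complex.Re (E j i)) (entry _ i j dRe))
                   (is_deriveZ (complex.Im (E j i)) (entry _ i j dIm)).
by rewrite !mxE.
Qed.

(** Hermiticity and unit trace hold on a whole neighbourhood of [theta], so both identities can be
    differentiated there. *)
Lemma pderiv_density rho theta a : parametrization rho theta ->
  pderiv rho theta a \is hermsymmx /\ prob (pderiv rho theta a) 1%:M = 0.
Proof.
move=> par; have [_ dRe dIm _] := nbhs_singleton par.
have dens : \forall t \near theta, density (rho t).
  by apply: filterS par => t [].
split; last first.
  rewrite -(derive_prob a 1%:M dRe dIm) -(derive_cst (1 : R) theta 'e_a).
  apply: near_eq_derive; near=> t.
  have [_ tr1] : density (rho t) by near: t.
  by rewrite /prob mulmx1 tr1.
have herm i j : \forall t \near theta, rho t j i = Num.conj (rho t i j).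
  near=> t; have [[/hermsymmxP /matrixP /(_ j i)]] : density (rho t) by near: t.
  by rewrite !mxE.
apply/hermsymmxP/matrixP => i j; rewrite !mxE.
rewrite (derive_mx (@diff_derivable _ _ _ _ _ 'e_a dRe)).
rewrite (derive_mx (@diff_derivable _ _ _ _ _ 'e_a dIm)) !mxE.
have -> : 'D_('e_a) (fun t => (mxRe \o rho) t j i) theta =
    'D_('e_a) (fun t => (mxRe \o rho) t i j) theta.
  apply: near_eq_derive; near=> t; rewrite /= !mxE.
  have -> : rho t j i = Num.conj (rho t i j) by near: t; exact: herm.
  by case: (rho t i j).
have -> : 'D_('e_a) (fun t => (mxIm \o rho) t j i) theta =
    'D_('e_a) (- (fun t => (mxIm \o rho) t i j)) theta.
  apply: near_eq_derive; near=> t; rewrite opprfctE /= !mxE.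
  have -> : rho t j i = Num.conj (rho t i j) by near: t; exact: herm.
  by case: (rho t i j).
rewrite deriveN; first by apply/eqP; rewrite eq_complex /= opprK !eqxx.
by have /derivable_mxP := @diff_derivable _ _ _ _ _ 'e_a dIm; apply.
Unshelve. all: by end_near.
Qed.

Lemma derive_affine (f : 'rV[R]_g -> 'M[R]_d) t v M :
  (forall h, f (h *: v + t) = f t + h *: M) -> 'D_v f t = M.
Proof.
(* The difference quotient equals [M] whenever [h != 0], and the limit ignores [h = 0]. *)
move=> fE; apply/lim_near_cst => //=; near=> h.
rewrite fE addrAC subrr add0r scalerA mulVf ?scale1r //.
by near: h; exact: nbhs_dnbhs_neq.
Unshelve. all: by end_near.
Qed.

(** A flat chart through [s]: its partial derivatives are the directions [E a] at every point. *)
Definition affine_param (s : 'M[C]_d) (E : 'I_g -> 'M[C]_d) t : 'M[C]_d :=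
  s + \sum_a (t 0 a)%:C *: E a.

Lemma affine_paramRe s E t :
  mxRe (affine_param s E t) = mxRe s + \sum_a t 0 a *: mxRe (E a).
Proof.
rewrite /mxRe map_mxD; congr (_ + _).
have -> : map_mx (@complex.Re R) (\sum_a (t 0 a)%:C *: E a) =
    \sum_a map_mx (@complex.Re R) ((t 0 a)%:C *: E a).
  apply: (big_morph (map_mx (@complex.Re R))) => [M N|].
    by apply/matrixP => i j; rewrite !mxE ReD.
  by apply/matrixP => i j; rewrite !mxE.
apply: eq_bigr => a _; apply/matrixP => i j; rewrite !mxE.
exact: Re_real_mul.
Qed.

Lemma affine_paramIm s E t :
  mxIm (affine_param s E t) = mxIm s + \sum_a t 0 a *: mxIm (E a).
Proof.
have ImD (y z : C) : complex.Im (y + z) = complex.Im y + complex.Im z.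
  by case: y z => a b [a' b'].
rewrite /mxIm map_mxD; congr (_ + _).
have -> : map_mx (@complex.Im R) (\sum_a (t 0 a)%:C *: E a) =
    \sum_a map_mx (@complex.Im R) ((t 0 a)%:C *: E a).
  apply: (big_morph (map_mx (@complex.Im R))) => [M N|].
    by apply/matrixP => i j; rewrite !mxE ImD.
  by apply/matrixP => i j; rewrite !mxE.
apply: eq_bigr => a _; apply/matrixP => i j; rewrite !mxE.
by case: (E a i j) => x y /=; rewrite mul0r addr0.
Qed.

Lemma differentiable_affine (M : 'M[R]_d) (N : 'I_g -> 'M[R]_d) t :
  differentiable (fun u : 'rV[R]_g => M + \sum_a u 0 a *: N a) t.
Proof.
have -> : (fun u : 'rV[R]_g => M + \sum_a u 0 a *: N a) =
    cst M + \sum_a (fun u : 'rV[R]_g => u 0 a *: N a).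
  by apply/funext => u; rewrite addrfctE fct_sumE.
apply: differentiableD; first exact: differentiable_cst.
apply: differentiable_sum => a.
by apply: differentiableZl; exact: differentiable_coord.
Qed.

Lemma derive_coord_affine (M : 'M[R]_d) (N : 'I_g -> 'M[R]_d) t a :
  'D_('e_a) (fun u : 'rV[R]_g => M + \sum_b u 0 b *: N b) t = N a.
Proof.
apply: derive_affine => h.
have hN : h *: N a = \sum_b (h *: 'e_a : 'rV[R]_g) 0 b *: N b.
  rewrite (bigD1 a) //= big1 ?addr0 => [|b ba]; rewrite !mxE ?eqxx ?mulr1 //.
  by rewrite (negbTE ba) mulr0 scale0r.
rewrite hN -addrA -big_split /=; congr (_ + _); apply: eq_bigr => b _.
by rewrite -scalerDl mxE addrC.
Qed.

Lemma pderiv_affine s E t a : pderiv (affine_param s E) t a = E a.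
Proof.
have -> : pderiv (affine_param s E) t a =
    \matrix_(i, j) ((mxRe (E a) i j) +i* (mxIm (E a) i j)).
  apply/matrixP => i j; rewrite 2!mxE.
  have -> : mxRe \o affine_param s E = fun u => mxRe s + \sum_a u 0 a *: mxRe (E a).
    by apply/funext => u; exact: affine_paramRe.
  have -> : mxIm \o affine_param s E = fun u => mxIm s + \sum_a u 0 a *: mxIm (E a).
    by apply/funext => u; exact: affine_paramIm.
  by rewrite !derive_coord_affine.
by apply/matrixP => i j; rewrite !mxE; case: (E a i j).
Qed.

End Derivatives.

(** * Existence of a parametrization at every density matrix *)

Section Parametrization.
Variables (R : realType) (d : nat).
Local Notation C := R[i].
Local Notation mxRe := (@mxRe R d).
Local Notation mxIm := (@mxIm R d).
Local Notation g := (d ^ 2 - 1)%N.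

(** Inverts [hermvec]: the symmetric part of the real matrix becomes the real part, the
    antisymmetric part the imaginary part. *)
Definition vecherm (v : 'rV[R]_(d * d)) : 'M[C]_d :=
  \matrix_(i, j) (((vec_mx v i j + vec_mx v j i) / 2) +i*
                  ((vec_mx v i j - vec_mx v j i) / 2)).

Lemma vecherm_herm v : vecherm v \is hermsymmx.
Proof.
apply/hermsymmxP/matrixP => i j; rewrite !mxE; apply/eqP.
by rewrite eq_complex /= addrC eqxx -mulNr opprB eqxx.
Qed.

Lemma vechermK : cancel vecherm (@hermvec R d).
Proof.
move=> v; rewrite -[RHS]vec_mxK; congr mxvec; apply/matrixP => i j.
rewrite !mxE /=; lra.
Qed.

Lemma hermsymmx_trace (X : 'M[C]_d) : X \is hermsymmx -> \tr X = (prob X 1%:M)%:C.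
Proof.
move=> /hermsymmxP Xh; rewrite /prob mulmx1 RRe_real // CrealE.
by rewrite -[in X in _ == X]Xh trace_map_mx mxtrace_tr.
Qed.

Lemma prob_vecherm v : prob (vecherm v) 1%:M = \tr (vec_mx v).
Proof.
rewrite /prob mulmx1 /mxtrace Re_sum; apply: eq_bigr => i _.
rewrite mxE /=; lra.
Qed.

(** The trace is a nonzero functional on real coordinates of dimension [d * d], so its kernel has
    dimension [d ^ 2 - 1]; [vecherm] carries a basis of the kernel to Hermitian matrices. *)
Lemma traceless_basis : (0 < d)%N -> exists E : 'I_g -> 'M[C]_d,
  [/\ forall a, E a \is hermsymmx, forall a, prob (E a) 1%:M = 0 &
      forall c : 'I_g -> R, \sum_a (c a)%:C *: E a = 0 -> forall a, c a = 0].
Proof.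
move=> d0.
pose u : 'cV[R]_(d * d) := \col_k \tr (vec_mx (delta_mx 0 k)).
have uE v : (v *m u) 0 0 = \tr (vec_mx v).
  rewrite [in RHS](row_sum_delta v) !raddf_sum /= mxE; apply: eq_bigr => k _.
  by rewrite mxE linearZ /= mxtraceZ.
have u_rank : \rank u = 1%N.
  apply/eqP; rewrite eqn_leq rank_leq_col lt0n mxrank_eq0.
  apply/eqP => u0; have := uE (mxvec 1%:M).
  rewrite u0 mulmx0 mxvecK mxtrace1 mxE => /esym/eqP.
  by rewrite pnatr_eq0 -[_ == _]negbK -lt0n d0.
have [B Bfree Bu] : exists2 B : 'M[R]_(g, d * d), row_free B & B *m u = 0.
  have <- : \rank (kermx u) = g by rewrite mxrank_ker u_rank mulnn.
  exists (row_base (kermx u)); first exact: row_base_free.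
  by apply/sub_kermxP; rewrite eq_row_base.
exists (fun a => vecherm (row a B)); split=> [a|a|c c0].
- exact: vecherm_herm.
- by rewrite prob_vecherm -uE -row_mul Bu !mxE.
- have : (\row_a c a) *m B = 0.
    have := congr1 (@hermvec R d) c0; rewrite hermvec_sum.
    rewrite hermvec0 mulmx_sum_row => {2}<-; apply: eq_bigr => a _.
    by rewrite vechermK mxE.
  move=> cB; have c0' : \row_a c a = 0 :> 'rV_g.
    by apply: (row_free_inj Bfree); rewrite cB mul0mx.
  by move=> a; move/rowP/(_ a): c0'; rewrite !mxE.
Qed.

Definition mxform (X : 'M[C]_d) (x : 'cV[C]_d) : R :=
  complex.Re ((x ^t* *m X *m x) 0 0).

Lemma mxform_herm X x : X \is hermsymmx ->
  (x ^t* *m X *m x) 0 0 = (mxform X x)%:C.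
Proof.
move=> /hermsymmxP Xh; rewrite RRe_real // CrealE; apply/eqP.
have conj00 (M : 'M[C]_1) : Num.conj (M 0 0) = (M ^t*) 0 0 by rewrite !mxE.
by rewrite conj00 !adjmxM Xh trmxCK mulmxA.
Qed.

(** Substitute [y = K *m x] with [K] a square root of [s]. The form of [X] becomes that of
    [M = K^-1 X K^-1] at [y], bounded by the sum of the norms of the entries of [M] times the
    squared norm of [y], and this squared norm is the form of [s] at [x]. *)
Lemma mxform_bound s X : posdefmx s ->
  exists2 c : R, 0 <= c & forall x, `|mxform X x| <= c * mxform s x.
Proof.
move=> sp; have [K [Kp KK]] := posdefmx_sqrt sp.
have /hermsymmxP Kh := Kp.1; have Ku := posdefmx_unit Kp.
pose M := invmx K *m X *m invmx K.
pose c := \sum_i \sum_j `|M i j|.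
have c0 : 0 <= c by do 2![apply: sumr_ge0 => ? _].
have cR : (complex.Re c)%:C = c by rewrite RRe_real // ger0_real.
exists (complex.Re c) => [|x]; first by rewrite -ler0c cR.
pose y := K *m x.
have yE : x ^t* *m X *m x = y ^t* *m M *m y.
  by rewrite /y /M adjmxM Kh -!mulmxA (mulmxA (invmx K) K) mulVmx // mul1mx mulKVmx.
have sE : (x ^t* *m s *m x) 0 0 = \sum_i `|y i 0| ^+ 2.
  by rewrite -KK -{1}Kh adjmul_form mxtrace_adjmul_sum big_ord1.
clearbody y; set N := \sum_i _ in sE.
have yN i : `|y i 0| ^+ 2 <= N.
  by rewrite /N (bigD1 i) //= lerDl sumr_ge0 // => k _; rewrite exprn_ge0.
rewrite -lecR rmorphM /= cR -(mxform_herm _ sp.1) sE.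
apply: le_trans (normc_ge_Re _) _.
rewrite yE -mulmxA mxE (le_trans (ler_norm_sum _ _ _)) //.
rewrite /c mulr_suml ler_sum // => i _; rewrite [X in _ * X]mxE mulr_sumr mulr_suml.
rewrite (le_trans (ler_norm_sum _ _ _)) // ler_sum // => j _.
rewrite !normrM mulrCA ler_wpM2l // !mxE norm_conjC.
(* The product of two norms is at most the square of the larger one. *)
have [yij|yji] := real_leP (normr_real (y i 0)) (normr_real (y j 0)).
  by apply: le_trans (yN j); rewrite expr2; apply: ler_wpM2r.
by apply: le_trans (yN i); rewrite expr2; apply: ler_wpM2l; rewrite // ltW.
Qed.

(** Each direction is dominated by the form of [s] uniformly in [x], so a small [t] cannot destroy
    positivity; the trace stays 1 because the directions are traceless. *)
Lemma near_density s (E : 'I_g -> 'M[C]_d) : density s ->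
    (forall a, E a \is hermsymmx) -> (forall a, prob (E a) 1%:M = 0) ->
  \forall t \near (0 : 'rV[R]_g), density (affine_param s E t).
Proof.
move=> [sp trs] Eh E0.
have /(_ _)/cid2 c_ a := mxform_bound (E a) sp.
pose c a := s2val (c_ a).
have c_ge0 a : 0 <= c a by exact: s2valP (c_ a).
have c_bound a x : `|mxform (E a) x| <= c a * mxform s x.
  exact: (s2valP' (c_ a)).
pose k := \sum_a c a.
have k_ge0 : 0 <= k by exact: sumr_ge0.
(* The radius [1 / (k + 1)] forces [k] times the norm of [t] below 1, also when [k = 0]. *)
have k1 : 0 < (k + 1)^-1 by rewrite invr_gt0 ltr_wpDl.
near=> t.
have tk : `|t| < (k + 1)^-1.
  by near: t; exact: (@nbhs0_lt R ('rV[R]_g : normedModType R) _ k1).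
have ta a : `|t 0 a| <= `|t|.
  rewrite [leRHS]/Num.Def.normr/= mx_normrE.
  exact: (le_bigmax _ (fun i : 'I_1 * 'I_g => `|t i.1 i.2|) (0, a)).
have th : affine_param s E t \is hermsymmx.
  by apply: hermsymmxD; [exact: sp.1 | exact: hermsymmx_sum].
split; last first.
  rewrite /affine_param raddfD /= trs raddf_sum /= big1 ?addr0 // => a _.
  by rewrite mxtraceZ hermsymmx_trace // E0 mulr0.
split=> // x x0.
have formE : mxform (affine_param s E t) x =
    mxform s x + \sum_a t 0 a * mxform (E a) x.
  rewrite /mxform /affine_param mulmxDr mulmxDl mxE ReD; congr (_ + _).
  rewrite mulmx_sumr mulmx_suml summxE Re_sum.
  apply: eq_bigr => a _.
  by rewrite -scalemxAr -scalemxAl mxE Re_real_mul.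
have sx : 0 < mxform s x by rewrite -ltcR -mxform_herm ?sp.2 //; exact: sp.1.
rewrite mxform_herm // ltcR formE.
have : `|\sum_a t 0 a * mxform (E a) x| < mxform s x.
  apply: (@le_lt_trans _ _ (`|t| * k * mxform s x)).
    rewrite mulr_sumr mulr_suml (le_trans (ler_norm_sum _ _ _)) // ler_sum // => a _.
    by rewrite normrM -mulrA ler_pM.
  rewrite gtr_pMl // (@le_lt_trans _ _ (`|t| * (k + 1))) //.
    by rewrite ler_wpM2l // lerDl.
  by rewrite -ltr_pdivlMr ?div1r // ltr_wpDl.
by rewrite ltr_norml => /andP[+ _]; rewrite -subr_gt0 opprK addrC.
Unshelve. all: by end_near.
Qed.

Lemma affine_parametrization s E : density s ->
    (forall a, E a \is hermsymmx) -> (forall a, prob (E a) 1%:M = 0) ->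
    (forall c : 'I_g -> R, \sum_a (c a)%:C *: E a = 0 -> forall a, c a = 0) ->
  parametrization (affine_param s E) 0.
Proof.
move=> sd Eh E0 Efree; rewrite /parametrization.
apply: filterS (near_density sd Eh E0) => t td; split=> //.
- have -> : mxRe \o affine_param s E = fun u => mxRe s + \sum_a u 0 a *: mxRe (E a).
    by apply/funext => u; exact: affine_paramRe.
  exact: differentiable_affine.
- have -> : mxIm \o affine_param s E = fun u => mxIm s + \sum_a u 0 a *: mxIm (E a).
    by apply/funext => u; exact: affine_paramIm.
  exact: differentiable_affine.
- move=> c; under eq_bigr do rewrite pderiv_affine.
  exact: Efree.
Qed.

(** Supplies the parametrization that [fisher_sharp] asks for at a given state: the affine chart
    along a traceless Hermitian basis. *)
Lemma density_parametrization (s : 'M[C]_d) : (0 < d)%N -> density s ->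
  exists (rho : 'rV[R]_g -> 'M[C]_d) (theta : 'rV[R]_g),
    parametrization rho theta /\ rho theta = s.
Proof.
move=> d0 sd; have [E [Eh E0 Efree]] := traceless_basis d0.
exists (affine_param s E), 0; split; first exact: affine_parametrization.
by rewrite /affine_param big1 ?addr0 // => a _; rewrite mxE scale0r.
Qed.

End Parametrization.

(** * The equality case of Kadison's inequality, and orthogonality of projectors *)

Section PositiveFamilies.
Variables (R : realType) (d n : nat).
Local Notation C := R[i].
Variables (s : 'M[C]_d) (A : 'I_n -> 'M[C]_d).
Hypothesis sp : posdefmx s.
Hypothesis Ap : forall j, possemidefmx (A j).
Hypothesis A1 : \sum_j A j = 1%:M.

Lemma prob_sum (I : finType) (X : I -> 'M[C]_d) :
  prob s (\sum_i X i) = \sum_i prob s (X i).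
Proof.
rewrite -jordan_form1 jordan_form_sum.
by apply: eq_bigr => i _; rewrite jordan_form1.
Qed.

(** Writing [E = B *m B], the probability is [<B, B>] with [B] nonzero. *)
Lemma prob_possemidef_gt0 (E : 'M[C]_d) :
  possemidefmx E -> E != 0 -> 0 < prob s E.
Proof.
move=> /possemidefmx_sqrt[B [Bp BB]] E0.
have -> : prob s E = jordan_form s B B.
  by rewrite -jordan_form1 /jordan_form mul1mx mulmx1 BB.
apply: jordan_form_gt0 => //; first exact: Bp.1.
by apply: contraNneq E0 => B0; rewrite -BB B0 mulmx0.
Qed.

(* Equality case of Kadison's inequality: the defect of
   [sum_j <A_j, X>^2 / p_j <= <X, X>] is [sum_j tr (s (f_j - X) A_j (f_j - X))]
   with [f_j = <A_j, X> / p_j]. *)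
Lemma parseval_eigen (X : 'M[C]_d) : X \is hermsymmx ->
    (forall j, 0 < prob s (A j)) ->
    \sum_j jordan_form s (A j) X ^+ 2 / prob s (A j) = jordan_form s X X ->
  forall j, X *m A j = (jordan_form s (A j) X / prob s (A j))%:C *: A j.
Proof.
move=> Xh p0 parseval.
have [K [Kp KK]] := posdefmx_sqrt sp.
have /hermsymmxP Kh := Kp.1; have Xh' := hermsymmxP _ Xh.
pose f j := jordan_form s (A j) X / prob s (A j).
pose T j := (f j)%:C *: 1%:M - X.
have Th j : T j \is hermsymmx by apply/hermsymmxB => //; apply/hermsymmxZ/hermsymmx1.
have /(_ _)/cid B_ j := possemidefmx_sqrt (Ap j).
pose B j := sval (B_ j).
have Bp j : possemidefmx (B j) by exact: (svalP (B_ j)).1.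
have BB j : B j *m B j = A j by exact: (svalP (B_ j)).2.
pose Y j := B j *m T j *m K.
have YE j : \tr ((Y j) ^t* *m Y j) = \tr (s *m (T j *m A j *m T j)).
  rewrite /Y !adjmxM Kh (hermsymmxP _ (Th j)) (hermsymmxP _ (Bp j).1) -BB -KK.
  by rewrite -[in RHS]mulmxA [RHS]mxtrace_mulC !mulmxA.
(* With [q = <A_j, X>] and [f_j = q / p_j], the terms other than [X A_j X] contribute
   [f_j^2 p_j - 2 f_j q = - q^2 / p_j]. *)
have pTAT j : prob s (T j *m A j *m T j) =
    prob s (X *m A j *m X) - jordan_form s (A j) X ^+ 2 / prob s (A j).
  have -> : T j *m A j *m T j =
      (f j ^+ 2)%:C *: A j + (- f j)%:C *: (A j *m X + X *m A j) + X *m A j *m X.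
    rewrite rmorphXn rmorphN /= /T mulmxBl -scalemxAl mul1mx mulmxBr.
    rewrite -scalemxAr mulmx1 mulmxBl -scalemxAl.
    move: (X *m A j) (A j *m X) (X *m A j *m X) => M N P.
    by apply/matrixP => i k; rewrite !mxE; ring.
  rewrite -jordan_form1 !jordan_formD !jordan_formZ.
  have -> : jordan_form s 1%:M (A j *m X + X *m A j) = 2 * jordan_form s (A j) X.
    have two_half (z : C) : complex.Re z = 2 * complex.Re (2^-1 * z).
      by rewrite -Re_real_mul mulrA rmorph_nat divff ?pnatr_eq0 // mul1r.
    by rewrite jordan_form1 /prob two_half.
  rewrite !jordan_form1 /f.
  have := lt0r_neq0 (p0 j); set p := prob s (A j); set q := jordan_form _ _ _ => pn0.
  by field.
(* Completeness sums the terms [X A_j X] to [X^2], and [parseval] makes the total defect vanish. *)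
have sum0 : \sum_j complex.Re (\tr ((Y j) ^t* *m Y j)) = 0.
  under eq_bigr do rewrite YE -/(prob s _) pTAT.
  rewrite sumrB parseval -prob_sum -mulmx_suml -mulmx_sumr A1 mulmx1.
  by rewrite -jordan_form1 /jordan_form mul1mx mulmx1 subrr.
move=> j.
have Yj : Y j = 0.
  apply: mxtrace_adjmul_eq0.
  have Yge0 i : 0 <= complex.Re (\tr ((Y i) ^t* *m Y i)).
    by rewrite -ler0c RRe_real ?ger0_real ?mxtrace_adjmul_ge0.
  move/eqP: sum0; rewrite psumr_eq0 // => /allP /(_ j).
  rewrite mem_index_enum => /(_ isT) /= /eqP Re0.
  by rewrite -[LHS]RRe_real ?Re0 // ger0_real // mxtrace_adjmul_ge0.
(* Cancelling the invertible [K] in [Y j = 0] gives [A_j T_j = 0], whose adjoint is the eigenvalue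
   equation. *)
have AT : A j *m T j = 0.
  rewrite -BB -mulmxA -(mulmxK (posdefmx_unit Kp) (B j *m T j)) -/(Y j) Yj.
  by rewrite mul0mx mulmx0.
have := congr1 (fun M => M ^t*) AT.
rewrite /= adjmxM (hermsymmxP _ (Th j)) (hermsymmxP _ (Ap j).1) trmx0 map_mx0.
by rewrite /T mulmxBl -scalemxAl mul1mx => /eqP; rewrite subr_eq0 => /eqP <-.
Qed.

(** By completeness the squared norms of [A i *m A k], summed over [i], give [\tr (A k)]. The term
    [i = k] already has this value, so the other nonnegative terms vanish. *)
Lemma projectors_orthogonal : (forall j, projector (A j)) ->
  forall j k, j != k -> A j *m A k = 0.
Proof.
move=> Aproj j k jk.
have Ah i := hermsymmxP _ (Aproj i).1.
have : \sum_(i | i != k) \tr ((A i *m A k) ^t* *m (A i *m A k)) = 0.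
  have : \sum_i \tr ((A i *m A k) ^t* *m (A i *m A k)) = \tr (A k).
    rewrite -raddf_sum /=; congr mxtrace.
    under eq_bigr => i _ do rewrite adjmxM !Ah -mulmxA (mulmxA (A i) (A i)) (Aproj i).2.
    by rewrite -mulmx_sumr -mulmx_suml A1 mul1mx (Aproj k).2.
  rewrite (bigD1 k) //= adjmxM !Ah -mulmxA !(Aproj k).2.
  by rewrite -[RHS]addr0 => /addrI.
move/eqP; rewrite psumr_eq0 => [/allP /(_ j)|i _]; last exact: mxtrace_adjmul_ge0.
by rewrite mem_index_enum jk => /(_ isT) /= /eqP /mxtrace_adjmul_eq0.
Qed.

End PositiveFamilies.

(** * Gram matrices of the logarithmic derivatives *)

Section Gram.
Variables (R : realType) (d : nat).
Local Notation C := R[i].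
Local Notation g := (d ^ 2 - 1)%N.

Definition gram_mx s (L : 'I_g -> 'M[C]_d) : 'M[R]_g :=
  \matrix_(a, b) jordan_form s (L a) (L b).

(** The form at [x] is [<S, S>] for the combination [S] of the [L a] with coefficients [x], nonzero
    by independence. *)
Lemma gram_mx_posdef s (L : 'I_g -> 'M[C]_d) : posdefmx s ->
    (forall a, L a \is hermsymmx) ->
    (forall c : 'I_g -> R, \sum_a (c a)%:C *: L a = 0 -> forall a, c a = 0) ->
  real_posdefmx (gram_mx s L).
Proof.
move=> sp Lh Lfree; split=> [|x x0].
  by apply/symmetricmxP/matrixP => a b; rewrite !mxE jordan_formC.
have -> : (x^T *m gram_mx s L *m x) 0 0 =
    jordan_form s (\sum_a (x a 0)%:C *: L a) (\sum_a (x a 0)%:C *: L a).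
  rewrite -mulmxA mxE jordan_form_sum; apply: eq_bigr => a _.
  rewrite !mxE jordan_formZ (jordan_formC _ _ (L a)) jordan_form_sum; congr (_ * _).
  by apply: eq_bigr => b _; rewrite !mxE jordan_formZ mulrC.
apply: jordan_form_gt0 => //; first exact: hermsymmx_sum.
apply: contraNneq x0 => /Lfree x0; apply/eqP/colP => a.
by rewrite x0 mxE.
Qed.

(** The left side is the Gram matrix of the orthogonal projections of the [A j] onto the span of the
    [L a], the complement of the identity. These projections are [A_j - p_j], and their pairings are
    the covariances on the right. *)
Lemma gram_mx_inv s (L : 'I_g -> 'M[C]_d) n (A : 'I_n -> 'M[C]_d) : (0 < d)%N ->
    posdefmx s -> prob s 1%:M = 1 ->
    (forall a, L a \is hermsymmx) -> (forall a, jordan_form s 1%:M (L a) = 0) ->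
    (forall c : 'I_g -> R, \sum_a (c a)%:C *: L a = 0 -> forall a, c a = 0) ->
    (forall j, A j \is hermsymmx) ->
    let V := \matrix_(a, j) jordan_form s (L a) (A j) in
  V^T *m invmx (gram_mx s L) *m V =
  \matrix_(j, k) (jordan_form s (A j) (A k) - prob s (A j) * prob s (A k)).
Proof.
move=> d0 sp s1 Lh sL Lfree Ah V.
have /(_ _)/cid c_ k := hermsymmx_span d0 s1 Lh sL Lfree (Ah k).
pose c k := sval (c_ k).
have AE k : A k = (prob s (A k))%:C *: 1%:M + \sum_a (c k a)%:C *: L a.
  exact: svalP (c_ k).
have AformE X k : jordan_form s X (A k) =
    prob s (A k) * prob s X + \sum_a c k a * jordan_form s X (L a).
  rewrite [in LHS]AE jordan_formD jordan_formZ jordan_formC jordan_form1.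
  by rewrite jordan_form_sum; congr (_ + _); apply: eq_bigr => a _; rewrite jordan_formZ.
pose Cc : 'M[R]_(g, n) := \matrix_(a, k) c k a.
(* [Cc] holds the coordinates of the [A k] along the [L a]; this factorization cancels the inverse
   Gram matrix. *)
have VE : V = gram_mx s L *m Cc.
  apply/matrixP => a k; rewrite !mxE AformE -(jordan_form1 s (L a)) sL mulr0 add0r.
  by apply: eq_bigr => b _; rewrite !mxE mulrC.
rewrite {2}VE -mulmxA mulKmx; last exact/real_posdefmx_unit/gram_mx_posdef.
apply/matrixP => j k; rewrite !mxE AformE addrAC [prob s (A k) * _]mulrC subrr add0r.
by apply: eq_bigr => a _; rewrite !mxE jordan_formC mulrC.
Qed.

End Gram.

(** * Fisher information and sharpness in terms of inner products *)

Section FisherSharp.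
Variables (R : realType) (d : nat).
Local Notation C := R[i].
Local Notation g := (d ^ 2 - 1)%N.
Implicit Types (rho : 'rV[R]_g -> 'M[C]_d) (theta : 'rV[R]_g).

(** Cyclicity of the trace moves the symmetrization onto [sld s X], where the defining equation
    applies. Derivatives of probabilities thereby become inner products. *)
Lemma jordan_form_sld (s X Y : 'M[C]_d) : posdefmx s -> X \is hermsymmx ->
  jordan_form s (sld s X) Y = prob X Y :> R.
Proof.
move=> sp Xh; rewrite /jordan_form -mxtraceZ scalemxAr.
have [_ XE] := sldP sp Xh; rewrite /prob -[in RHS]XE; congr complex.Re.
rewrite -scalemxAl -scalemxAr !mxtraceZ mulmxDl mulmxDr !mxtraceD; congr (_ * (_ + _)).
  by rewrite mulmxA.
by rewrite mulmxA mxtrace_mulC mulmxA.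
Qed.

Definition slds rho theta (a : 'I_g) : 'M[C]_d :=
  sld (rho theta) (pderiv rho theta a).

Lemma jordan_form_slds rho theta a Y : parametrization rho theta ->
  jordan_form (rho theta) (slds rho theta a) Y = prob (pderiv rho theta a) Y.
Proof.
move=> par; have [[sp _] _ _ _] := nbhs_singleton par.
exact: jordan_form_sld sp (pderiv_density a par).1.
Qed.

(** Orthogonality to the identity reflects that the derivatives are traceless. The linear map
    [S |-> (rho S + S rho) / 2] sends a relation among the [slds] to one among the derivatives,
    which are independent. *)
Lemma slds_spec rho theta : parametrization rho theta ->
  [/\ forall a, slds rho theta a \is hermsymmx,
      forall a, jordan_form (rho theta) 1%:M (slds rho theta a) = 0 &
      forall c : 'I_g -> R, \sum_a (c a)%:C *: slds rho theta a = 0 ->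
        forall a, c a = 0].
Proof.
move=> par; have [[sp _] _ _ pfree] := nbhs_singleton par.
have ph a := (pderiv_density a par).1; have p0 a := (pderiv_density a par).2.
split=> [a|a|c c0].
- exact: (sldP sp (ph a)).1.
- by rewrite jordan_formC jordan_form_slds.
apply: pfree; set S := \sum_a (c a)%:C *: slds rho theta a in c0.
transitivity (2^-1 *: (rho theta *m S + S *m rho theta)); last first.
  by rewrite c0 mulmx0 mul0mx addr0 scaler0.
rewrite mulmx_sumr mulmx_suml -big_split scaler_sumr; apply: eq_bigr => a _ /=.
rewrite -[in LHS](sldP sp (ph a)).2 -scalemxAr -scalemxAl -scalerDr.
by rewrite !scalerA mulrC.
Qed.

(** The partial derivatives of [p_j] are the inner products [<L_a, A_j>]. Outcomes are enumerated by
    ['I_#|J|] so that they can index columns. *)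
Lemma fisher_infoE (J : finType) (A : J -> 'M[C]_d) rho theta :
    parametrization rho theta -> (forall j, A j != 0) ->
    let s := rho theta in
    let B (i : 'I_#|J|) := A (enum_val i) in
    let V := \matrix_(a, i) jordan_form s (slds rho theta a) (B i) in
  fisher_info A rho theta = V *m diag_mx (\row_i (prob s (B i))^-1) *m V^T.
Proof.
move=> par A0; have [[sp _] dRe dIm _] := nbhs_singleton par.
have LE a Y : jordan_form (rho theta) (slds rho theta a) Y =
    prob (pderiv rho theta a) Y.
  exact: jordan_form_slds.
move: (slds rho theta) LE => L LE s B V.
apply/matrixP => a b; rewrite mxE [RHS]mxE.
rewrite (reindex (fun i : 'I_#|J| => enum_val i)); last exact/onW_bij/enum_val_bij.
rewrite (eq_bigl predT) => [|i]; last by rewrite A0.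
apply: eq_bigr => i _; rewrite mul_mx_diag !mxE !derive_prob //.
rewrite /s !LE.
by rewrite [X in X * _]mulrC.
Qed.

Lemma fisher_sharpP (J : finType) (A : J -> 'M[C]_d) rho theta :
    parametrization rho theta -> (forall j, A j != 0) ->
    let F := fisher_info A rho theta in
  real_projector (adjusted_fisher_info A rho theta) <->
  F *m invmx (gram_mx (rho theta) (slds rho theta)) *m F = F.
Proof.
move=> par A0 F; have [[sp _] _ _ _] := nbhs_singleton par.
have [Lh _ Lfree] := slds_spec par.
(* [quantum_fisher_info] unfolds to [gram_mx] of the [slds], so it is positive definite. *)
apply: real_projector_invsqrt; first exact: gram_mx_posdef.
by apply/matrixP => a b; rewrite !mxE; apply: eq_bigr => j _; exact: mulrAC.
Qed.

End FisherSharp.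

(** * Sharpness at one state forces a PVM, and a PVM is sharp at every state *)

Section Main.
Variables (R : realType) (d : nat) (d_gt0 : (0 < d)%N).
Local Notation C := R[i].
Variables (J : finType) (A : J -> 'M[C]_d).
Hypothesis hA : simple_POVM A.

Let B (i : 'I_#|J|) := A (enum_val i).

Lemma enum_POVM_sum : \sum_i B i = 1%:M.
Proof.
have [[_ <-] _ _] := hA.
by rewrite [RHS](reindex (fun i : 'I_#|J| => enum_val i)) //; exact/onW_bij/enum_val_bij.
Qed.

Lemma POVM_sharp_PVM rho theta : parametrization rho theta ->
  real_projector (adjusted_fisher_info A rho theta) -> PVM A.
Proof.
have [[Ap A1] A0 Afree] := hA.
move=> par; have [[sp trs] _ _ _] := nbhs_singleton par.
have [Lh sL Lfree] := slds_spec par.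
move=> /(fisher_sharpP par A0); rewrite (fisher_infoE par A0) /=.
move: (slds rho theta) (rho theta) sp trs Lh sL Lfree => L s sp trs Lh sL Lfree.
rewrite -/B; set V := \matrix_(_, _) _; set w := \row_i _.
have s1 : prob s 1%:M = 1 by rewrite /prob mulmx1 trs.
have Bh i : B i \is hermsymmx by exact: (Ap _).1.
have p0 i : 0 < prob s (B i) by exact: (prob_possemidef_gt0 sp (Ap _) (A0 _)).
have w0 i : 0 < w 0 i by rewrite mxE invr_gt0; exact: p0.
have Ms : (gram_mx s L)^T = gram_mx s L.
  exact/symmetricmxP/(gram_mx_posdef sp Lh Lfree).1.
move=> /(gram_fisher_eq Ms w0) VG.
have /= GE := gram_mx_inv d_gt0 sp s1 Lh sL Lfree Bh; rewrite -/V in GE.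
set G := V^T *m _ *m V in VG GE.
(* Multiply [V W G = V] on the left by [V^T] times the inverse Gram matrix. *)
have GG : G *m diag_mx w *m G = G by rewrite {1}/G -!mulmxA (mulmxA V) VG !mulmxA.
clearbody G; pose m j k := jordan_form s (B j) (B k).
(* The diagonal entry of [G W G = G] reads [sum_j (m_jk - p_j p_k)^2 / p_j = m_kk - p_k^2]. On
   expanding, the cross terms drop out because the columns of [G] sum to zero. *)
have parseval k : \sum_j m j k ^+ 2 / prob s (B j) = m k k.
  have /matrixP /(_ k k) := GG; rewrite GE mul_mx_diag mxE [in RHS]mxE => GGk.
  have sumG : \sum_j (m j k - prob s (B j) * prob s (B k)) = 0.
    rewrite sumrB -mulr_suml -prob_sum enum_POVM_sum s1 mul1r.
    under eq_bigr do rewrite /m jordan_formC.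
    by rewrite -jordan_form_sum enum_POVM_sum jordan_formC jordan_form1 subrr.
  transitivity (\sum_j
      ((m j k - prob s (B j) * prob s (B k)) ^+ 2 / prob s (B j) +
       2 * prob s (B k) * (m j k - prob s (B j) * prob s (B k)) +
       prob s (B k) ^+ 2 * prob s (B j))).
    apply: eq_bigr => j _; have := lt0r_neq0 (p0 j); move: (prob s (B j)) => p pn0.
    by field.
  rewrite 2!big_split /= -!mulr_sumr sumG mulr0 addr0 -prob_sum enum_POVM_sum s1 mulr1.
  transitivity (m k k - prob s (B k) * prob s (B k) + prob s (B k) * prob s (B k)).
    congr (_ + _); apply: etrans GGk; apply: eq_bigr => j _; rewrite !mxE.
    by rewrite (jordan_formC _ (B k)) (mulrC (prob s (B k))) expr2 mulrAC.
  exact: subrK.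
have eigen k j : B k *m B j = (m j k / prob s (B j))%:C *: B j.
  by apply: (parseval_eigen sp (fun i => Ap _) enum_POVM_sum (Bh k) p0 (parseval k)).
(* If [B_k B_j = c B_j] with [c] nonzero, the adjoint [B_j B_k = c B_j], compared with
   [B_j B_k = c' B_k], puts [B_j] in the line of [B_k]. *)
have orth k j : j != k -> B k *m B j = 0.
  move=> jk; rewrite eigen.
  have [->|f0] := eqVneq (m j k / prob s (B j)) 0; first by rewrite scale0r.
  have : free [:: B j; B k] by apply: Afree; rewrite (inj_eq enum_val_inj).
  rewrite free_cons span_seq1 => /andP[/negP[]].
  have := congr1 (fun X => X ^t*) (eigen k j).
  rewrite /= adjmxM (hermsymmxP _ (Bh j)) (hermsymmxP _ (Bh k)).
  rewrite (hermsymmxP _ (hermsymmxZ _ (Bh j))) eigen => BE.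
  have f0C : (m j k / prob s (B j))%:C != 0 by rewrite -(inj_eq (@complexI R)) in f0.
  by rewrite -[B j]scale1r -(mulVf f0C) -scalerA -BE scalerA memvZ // memv_line.
split=> // j; split; first exact: (Ap j).1.
rewrite -[RHS]mulmx1 -enum_POVM_sum -[j]enum_rankK -/(B _) mulmx_sumr.
rewrite (bigD1 (enum_rank j)) //= big1 ?addr0 // => k kj.
exact: orth.
Qed.

Lemma PVM_sharp rho theta : PVM A -> parametrization rho theta ->
  real_projector (adjusted_fisher_info A rho theta).
Proof.
have [[Ap A1] A0 Afree] := hA.
move=> [_ Aproj] par; have [[sp trs] _ _ _] := nbhs_singleton par.
have [Lh sL Lfree] := slds_spec par.
apply/(fisher_sharpP par A0); rewrite (fisher_infoE par A0) /=.
move: (slds rho theta) (rho theta) sp trs Lh sL Lfree => L s sp trs Lh sL Lfree.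
rewrite -/B; set V := \matrix_(_, _) _; set w := \row_i _.
have s1 : prob s 1%:M = 1 by rewrite /prob mulmx1 trs.
have Bh i : B i \is hermsymmx by exact: (Ap _).1.
have p0 i : 0 < prob s (B i) by exact: (prob_possemidef_gt0 sp (Ap _) (A0 _)).
have /= GE := gram_mx_inv d_gt0 sp s1 Lh sL Lfree Bh; rewrite -/V in GE.
have orth := projectors_orthogonal enum_POVM_sum (fun i => Aproj (enum_val i)).
have BB j k : jordan_form s (B j) (B k) = (j == k)%:R * prob s (B k).
  rewrite /jordan_form; have [->|jk] := eqVneq j k.
    by rewrite mul1r -jordan_form1 /jordan_form mul1mx mulmx1 (Aproj _).2.
  by rewrite (orth j k jk) (orth k j) 1?eq_sym // addr0 mulmx0 raddf0 mulr0 mul0r.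
(* Orthogonality makes the middle factor [diag p - p p^T], so the product is [V] minus the row sums
   of [V] times [p^T]. Those sums are [<L_a, 1> = 0]. *)
have VG : V *m diag_mx w *m (V^T *m invmx (gram_mx s L) *m V) = V.
  rewrite GE mul_mx_diag; apply/matrixP => a k; rewrite mxE [RHS]mxE.
  transitivity (\sum_j ((j == k)%:R * jordan_form s (L a) (B j) -
                        prob s (B k) * jordan_form s (L a) (B j))).
    have alg (v p q : R) (e : bool) : p != 0 -> (e -> p = q) ->
        v * p^-1 * (e%:R * q - p * q) = e%:R * v - q * v.
      by case: e => p0' => [/(_ isT) <-|_] /=; field.
    apply: eq_bigr => j _; rewrite !mxE BB.
    by apply: alg => [|/eqP -> //]; exact: lt0r_neq0 (p0 j).
  rewrite sumrB -mulr_sumr -jordan_form_sum enum_POVM_sum jordan_formC sL mulr0 subr0.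
  rewrite (bigD1 k) //= eqxx mul1r big1 ?addr0 // => j /negbTE ->; exact: mul0r.
(* Multiplying [VG] on the right by [W V^T] produces the sharpness identity. *)
transitivity (V *m diag_mx w *m (V^T *m invmx (gram_mx s L) *m V) *m
              (diag_mx w *m V^T)).
  by rewrite !mulmxA.
by rewrite VG mulmxA.
Qed.

End Main.

(** Ensures that there is a state at all, so that sharpness at every state yields sharpness at some
    state. *)
Lemma density_maximally_mixed (R : realType) (d : nat) : (0 < d)%N ->
  exists sigma : 'M[R[i]]_d, density sigma.
Proof.
move=> d0; have dV0 : 0 < (d%:R^-1 : R) by rewrite invr_gt0 ltr0n.
exists (d%:R^-1%:C *: 1%:M); split; last first.
  rewrite mxtraceZ mxtrace1 -(rmorph_nat (real_complex R)) -rmorphM.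
  by rewrite mulVf ?pnatr_eq0 -?lt0n.
split=> [|x x0]; first exact/hermsymmxZ/hermsymmx1.
rewrite -scalemxAr mulmx1 -scalemxAl mxE mulr_gt0 ?ltcR //.
by rewrite -trace_mx11 mxtrace_adjmul_gt0.
Qed.

Theorem theorem2 (R : realType) (d : nat) (d_gt0 : (0 < d)%N)
    (J : finType) (A : J -> 'M[R[i]]_d) (hA : simple_POVM A) :
  [<-> PVM A;
       exists sigma : 'M[R[i]]_d, density sigma /\ fisher_sharp A sigma;
       universally_fisher_sharp A].
Proof.
have sharp_PVM sigma : fisher_sharp A sigma -> PVM A.
  by case=> rho [theta [par _]]; exact: POVM_sharp_PVM.
have PVM_universal : PVM A -> universally_fisher_sharp A.
  move=> hP sigma /(density_parametrization d_gt0)[rho [theta [par rhoE]]].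
  by exists rho, theta; split=> //; exact: PVM_sharp.
have mixed := density_maximally_mixed R d_gt0.
tfae.
- by move=> /PVM_universal; case: mixed => sigma sd /(_ _ sd); exists sigma.
- by case=> sigma [_ /sharp_PVM /PVM_universal].
- by case: mixed => sigma sd /(_ _ sd) /sharp_PVM.
Qed.
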